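(* Let $d \geq 1$ and let $\{X_i\}_{i=1}^{\infty}$ be an evenly distributed family of finite point sets in $B^d \subset \mathbb{R}^d$. Then $L(X_i) \leq O(|X_i|^{2/d})$ as $i\to\infty$.
   Context: $B^d$ denotes the closed Euclidean unit ball in $\mathbb{R}^d$ centered at the origin. For a set $A \subset \mathbb{R}^d$ (with at least two points), $\mu(A)$ denotes the minimum Euclidean distance between distinct points of $A$. Layer number: for a finite set $X \subset \mathbb{R}^d$, let $V(X)$ be the set of vertices (extreme points) of the convex hull $\mathrm{conv}\, X$. The peeling process starts with $X$ and in each step deletes from the current set all vertices of its convex hull, i.e. replaces the current set $Y$ by $Y \setminus V(Y)$, until the empty set is reached. The layer number $L(X)$ is the number of steps required to reach the empty set. Evenly distributed family: a family of finite sets $X_1, X_2, X_3, \dots \subset B^d$ is evenly distributed if $|X_i| \to \infty$ and $\mu(X_i) = \Theta(|X_i|^{-1/d})$ as $i\to\infty$, where the implied constants in $\Theta$ may depend on $d$ and on the family. The implied constant in the conclusion may depend on $d$ and on the constants in the asymptotic bound $\mu(X_i) = \Theta(|X_i|^{-1/d})$. *)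

(* Defs.v *)
From HB Require Import structures.
From mathcomp Require Import all_boot all_order all_algebra finmap.
From mathcomp Require Import all_classical all_reals all_analysis.
From mathcomp Require Import ring lra.

Set Implicit Arguments.
Unset Strict Implicit.
Unset Printing Implicit Defensive.

Import Order.TTheory GRing.Theory Num.Theory.
Import numFieldNormedType.Exports.

Local Open Scope fset_scope.
Local Open Scope classical_set_scope.
Local Open Scope ring_scope.

Section Euclidean.
Context {R : realType} {d : nat}.
Implicit Types (x y : 'rV[R]_d) (A : set 'rV[R]_d) (Y X : {fset 'rV[R]_d}).

(* The canonical norm [`|x|] on ['rV[R]_d] is the maximum norm. *)
Definition enorm x : R := Num.sqrt (\sum_(i < d) x ord0 i ^+ 2).

Definition eball : set 'rV[R]_d := [set x | enorm x <= 1].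

(* The infimum is over a finite set of distances, which is nonempty as soon as
   [X] has two points; it is then a minimum, see [min_distP]. *)
Definition min_dist X : R :=
  inf [set r | exists x y, [/\ x \in X, y \in X, x != y & r = enorm (x - y)]].

Definition conv_hull A : set 'rV[R]_d := smallest (@convex_set R 'rV[R]_d) A.

Definition extreme_points A : set 'rV[R]_d :=
  [set x | A x /\ forall y z (t : R), A y -> A z -> 0 < t < 1 ->
             x = t *: y + (1 - t) *: z -> y = x /\ z = x].

Definition vertices Y : set 'rV[R]_d := extreme_points (conv_hull [set` Y]).

Definition peel Y : {fset 'rV[R]_d} := [fset x in Y | x \notin vertices Y].

Lemma min_distP X : (1 < #|` X|)%N ->
  (exists x y, [/\ x \in X, y \in X, x != y & min_dist X = enorm (x - y)]) /\
  (forall x y, x \in X -> y \in X -> x != y -> min_dist X <= enorm (x - y)).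
Proof.
move=> X1; set P := fun u : X * X => val u.1 != val u.2.
have [u0 Pu0] : exists u, P u.
  have [x xX] : exists x, x \in X.
    by apply/fset0Pn; rewrite -cardfs_gt0 (ltn_trans _ X1).
  have [y] : exists y, y \in (X `\ x)%fset.
    by apply/fset0Pn; rewrite -cardfs_gt0; move: X1; rewrite (cardfsD1 x) xX.
  rewrite !inE => /andP[yx yX].
  by exists ([` xX], [` yX]); rewrite /P /= eq_sym.
have [u Pu umin] := @arg_minP _ R _ u0 P (fun u => enorm (val u.1 - val u.2)) Pu0.
set S := [set r | exists x y,
            [/\ x \in X, y \in X, x != y & r = enorm (x - y)]].
have lbS : lbound S (enorm (val u.1 - val u.2)).
  move=> _ [x [y [xX yX xy ->]]].
  exact: (umin ([` xX], [` yX]) xy).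
have Su : S (enorm (val u.1 - val u.2)).
  by exists (val u.1), (val u.2); split => //; exact: valP.
have E : min_dist X = enorm (val u.1 - val u.2).
  apply/eqP; rewrite eq_le; apply/andP; split.
    by apply: ge_inf => //; eexists; exact: lbS.
  by apply: lb_le_inf => //; eexists; exact: Su.
split; first by exists (val u.1), (val u.2); split => //; exact: valP.
by move=> x y xX yX xy; rewrite E; apply: lbS; exists x, y.
Qed.

Let q x : R := \sum_(i < d) x ord0 i ^+ 2.

Let q_conv (t : R) y z :
  q (t *: y + (1 - t) *: z) =
  t * q y + (1 - t) * q z - t * (1 - t) * q (y - z).
Proof.
rewrite /q !mulr_sumr -big_split/= -sumrB; apply: eq_bigr => i _.
by rewrite !mxE; ring.
Qed.

Let q_ge0 x : 0 <= q x.
Proof. by apply: sumr_ge0 => i _; exact: sqr_ge0. Qed.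

Let q_eq0 x : q x = 0 -> x = 0.
Proof.
move=> /eqP; rewrite psumr_eq0 => [/allP qx|i _]; last exact: sqr_ge0.
apply/rowP => i; rewrite mxE; apply/eqP.
by rewrite -sqrf_eq0 (implyP (qx i (mem_index_enum i))).
Qed.

Lemma vertices_neq0 Y : Y != fset0 -> exists2 x, x \in Y & vertices Y x.
Proof.
move=> /fset0Pn[x0 x0Y].
have [[x xY] _ xmax] :=
  @arg_maxP _ R Y [` x0Y] xpredT (fun u => q (val u)) isT.
have hullB : conv_hull [set` Y] `<=` [set y | q y <= q x].
  apply: smallest_sub => [y z t|y yY]; last exact: (xmax [` yY] isT).
  rewrite !inE/= => qy qz; have := q_conv t%:num y z; rewrite /conv/= => ->.
  have t0 : 0 <= t%:num by [].
  have t1 : t%:num <= 1 by [].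
  have := mulr_ge0 (mulr_ge0 t0 (_ : 0 <= 1 - t%:num)) (q_ge0 (y - z)).
  by rewrite subr_ge0 => /(_ t1); nra.
exists x => //; split; first exact: sub_gen_smallest.
move=> y z t /hullB/= qy /hullB/= qz /andP[t0 t1] xE.
have yz : y = z.
  apply/subr0_eq/q_eq0/eqP; rewrite eq_le q_ge0 andbT.
  have t10 : 0 < t * (1 - t) by rewrite mulr_gt0// subr_gt0.
  have := q_conv t y z; rewrite -xE => qE.
  by rewrite -(pmulr_rle0 _ t10); nra.
by move: xE; rewrite yz -scalerDl addrC subrK scale1r => ->.
Qed.

Lemma peel_proper Y : Y != fset0 -> (#|` peel Y| < #|` Y|)%N.
Proof.
move=> /vertices_neq0[x xY vx]; apply: fproper_ltn_card.
rewrite /fproper; apply/andP; split.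
  by apply/fsubsetP => y; rewrite !inE => /andP[].
by apply/negP => /fsubsetP /(_ x xY); rewrite !inE xY/= mem_set.
Qed.

Lemma peel_ends X : exists n, iter n peel X == fset0.
Proof.
have [n] := ubnP #|` X|; elim: n X => // n IH X Xn.
have [->|X0] := eqVneq X fset0; first by exists 0%N.
have [|m mE] := IH (peel X); first exact: leq_trans (peel_proper X0) _.
by exists m.+1; rewrite iterSr.
Qed.

Definition layer_number X : nat := ex_minn (peel_ends X).

(* A family is evenly distributed if this holds for some positive [c] and [C],
   the constants of the lower and of the upper bound in the Theta relation. *)
Definition evenly_distributed_with (c C : R) (X : nat -> {fset 'rV[R]_d}) : Prop :=
  [/\ forall i, [set` X i] `<=` eball,
      (fun i => #|` X i|) @ \oo --> \oo &
      \forall i \near \oo,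
        c * #|` X i|%:R `^ (- d%:R^-1) <= min_dist (X i)
          <= C * #|` X i|%:R `^ (- d%:R^-1)].

End Euclidean.

(* Main.v *)
Require Import Defs.
From mathcomp Require Import all_boot all_order all_algebra finmap.
From mathcomp Require Import all_classical all_reals all_analysis.
From mathcomp Require Import ring lra.

Import Order.TTheory GRing.Theory Num.Theory.
Import numFieldNormedType.Exports.

Local Open Scope fset_scope.
Local Open Scope classical_set_scope.
Local Open Scope ring_scope.

(* If [Y] lies in the ball [|y|^2 <= r] and has separation at least [m], then
   for [x] in [Y] with [|x|^2 > r - m^2] every [y] in the cap
   [<x, y> >= |x|^2] satisfies [|y - x|^2 <= |y|^2 - |x|^2 < m^2]. So the cap
   contains no other point of [Y], and [x] is a vertex. Each peeling step thus
   lowers the squared radius by [m^2], and [m^-2 + 1] steps empty a subset of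
   the unit ball. *)

Section Peeling.
Set Implicit Arguments.
Unset Strict Implicit.
Context {R : realType} {d : nat}.
Implicit Types (x y z : 'rV[R]_d) (Y X : {fset 'rV[R]_d}).

Definition dot x y : R := \sum_(i < d) x ord0 i * y ord0 i.

Lemma dot_conv x y z (t : R) :
  dot x (t *: y + (1 - t) *: z) = t * dot x y + (1 - t) * dot x z.
Proof.
rewrite /dot !mulr_sumr -big_split/=; apply: eq_bigr => i _.
by rewrite !mxE; ring.
Qed.

Lemma dotBB x y : dot (x - y) (x - y) = dot x x - 2 * dot x y + dot y y.
Proof.
rewrite /dot mulr_sumr -sumrB -big_split/=; apply: eq_bigr => i _.
by rewrite !mxE; ring.
Qed.

Lemma dot_ge0 x : 0 <= dot x x.
Proof. by apply: sumr_ge0 => i _; rewrite -expr2 sqr_ge0. Qed.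

Lemma enorm_sqr x : enorm x ^+ 2 = dot x x.
Proof.
rewrite /enorm sqr_sqrtr; last by apply: sumr_ge0 => i _; exact: sqr_ge0.
by apply: eq_bigr => i _; rewrite expr2.
Qed.

(** Adjoining only [x] to the open half-space keeps the set convex and leaves [x] as its sole point
    on the bounding hyperplane, as needed for extremality. *)
Lemma convex_open_halfspace_point x :
  convex_set [set y | y = x \/ dot x y < dot x x].
Proof.
suff combA (t : R) y z : 0 <= t -> t <= 1 ->
    y = x \/ dot x y < dot x x -> z = x \/ dot x z < dot x x ->
    t *: y + (1 - t) *: z = x \/ dot x (t *: y + (1 - t) *: z) < dot x x.
  by move=> y z t; rewrite !inE => yA zA; apply: combA.
(* At the endpoints the combination is [z] or [y] itself. For [0 < t < 1], a single point in the
   open half-space pulls the combination into it. *)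
have [->|t0] := eqVneq t 0; first by rewrite scale0r add0r subr0 scale1r.
have [->|t1] := eqVneq t 1; first by rewrite subrr scale0r addr0 scale1r.
rewrite le_eqVlt eq_sym (negPf t0)/= => {}t0.
rewrite le_eqVlt (negPf t1)/= => {}t1.
rewrite dot_conv => -[->|yx] [->|zx]; [left|right..]; [|nra..].
by rewrite -scalerDl addrC subrK scale1r.
Qed.

(** The functional [dot x] attains its maximum over the whole hull only at [x], so [x] is no proper
    average of other hull points. *)
Lemma exposed_vertex Y x : x \in Y ->
  (forall y, y \in Y -> y != x -> dot x y < dot x x) -> vertices Y x.
Proof.
move=> xY Yx.
have hullA : conv_hull [set` Y] `<=` [set y | y = x \/ dot x y < dot x x].
  apply: smallest_sub; first exact: convex_open_halfspace_point.
  by move=> y /= yY; have [->|/(Yx _ yY)] := eqVneq y x; [left|right].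
split; first exact: sub_gen_smallest.
move=> y z t /hullA/= yA /hullA/= zA /andP[t0 t1] xE.
have := dot_conv x y z t; rewrite -xE.
by case: yA zA => [->|yx] [->|zx] // dotE; exfalso; nra.
Qed.

(** Here [m] and [r] bound squared lengths. By contraposition, a point with squared norm above
    [r - m] is exposed and hence deleted. *)
Lemma peel_shrinks Y (m r : R) :
  (forall x y, x \in Y -> y \in Y -> x != y -> m <= dot (x - y) (x - y)) ->
  (forall x, x \in Y -> dot x x <= r) ->
  forall x, x \in peel Y -> dot x x <= r - m.
Proof.
move=> Ym Yr x; rewrite !inE => /andP[xY]; apply: contraNT.
rewrite -ltNge => xr; apply/mem_set/exposed_vertex => // y yY yx.
rewrite ltNge; apply/negP => xy.
have := Ym _ _ xY yY; rewrite eq_sym yx dotBB => /(_ isT).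
by have := Yr _ yY; lra.
Qed.

Lemma iter_peel_sub X k x : x \in iter k peel X -> x \in X.
Proof. by elim: k => //= k IH; rewrite !inE => /andP[/IH]. Qed.

Lemma iter_peel_shrinks X (m r : R) k :
  (forall x y, x \in X -> y \in X -> x != y -> m <= dot (x - y) (x - y)) ->
  (forall x, x \in X -> dot x x <= r) ->
  forall x, x \in iter k peel X -> dot x x <= r - m *+ k.
Proof.
move=> Xm Xr; elim: k => [|k IH] x; first by rewrite subr0; exact: Xr.
(* Separation passes to subsets, so the same [m] serves in every step. *)
rewrite mulrSr opprD addrA; apply: (peel_shrinks _ IH) => y z.
by move=> /iter_peel_sub yX /iter_peel_sub zX; exact: Xm.
Qed.

Lemma layer_number_le X (m : R) : 0 < m ->
  (forall x y, x \in X -> y \in X -> x != y -> m <= dot (x - y) (x - y)) ->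
  (forall x, x \in X -> dot x x <= 1) ->
  (layer_number X)%:R <= m^-1 + 1.
Proof.
(* The successor makes [k] strictly larger than [m^-1], so [1 - m *+ k] is negative and no squared
   norm lies below it. *)
move=> m0 Xm X1; set k := (Num.truncn m^-1).+1.
have kE : iter k peel X == fset0.
  apply/eqP/fsetP => x; rewrite inE; apply/negP => /(iter_peel_shrinks Xm X1).
  apply/negP; rewrite -ltNge; apply: lt_le_trans (dot_ge0 x).
  by rewrite subr_lt0 -mulr_natr -ltr_pdivrMl// mulr1 truncnS_gt.
rewrite /layer_number; case: ex_minnP => n _ /(_ k kE) nk.
rewrite (le_trans (_ : _ <= k%:R)) ?ler_nat// -natr1 lerD2r.
by rewrite truncn_le// invr_ge0 ltW.
Qed.

End Peeling.

Theorem theorem1p6 (R : realType) (d : nat) (hd : (1 <= d)%N)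
    (c C : R) (hc : 0 < c) (hC : 0 < C) :
  exists2 K : R, 0 < K &
    forall X : nat -> {fset 'rV[R]_d},
      evenly_distributed_with c C X ->
      \forall i \near \oo,
        (layer_number (X i))%:R <= K * #|` X i|%:R `^ (2 / d%:R).
Proof.
exists (c ^- 2 + 1) => [|X [Xball Xoo Xdist]].
  by rewrite addr_gt0// invr_gt0 exprn_gt0.
have Xgt1 : \forall i \near \oo, (1 < #|` X i|)%N.
  exact: (Xoo _ (nbhs_infty_gt 1)).
near=> i.
have n1 : (1 < #|` X i|)%N by near: i.
have /andP[dist_ge _] : c * #|` X i|%:R `^ (- d%:R^-1) <= min_dist (X i)
    <= C * #|` X i|%:R `^ (- d%:R^-1) by near: i.
set n : R := #|` X i|%:R; set s := n `^ d%:R^-1.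
have n_ge1 : 1 <= n by rewrite ler1n ltnW.
have s_ge1 : 1 <= s by rewrite -(powRr0 n) ler_powR// invr_ge0.
have s_gt0 : 0 < s by exact: lt_le_trans s_ge1.
have -> : n `^ (2 / d%:R) = s ^+ 2.
  by rewrite mulrC powRrM powR_mulrn// ltW.
have m0 : 0 < (c / s) ^+ 2 by rewrite exprn_gt0// divr_gt0.
apply: le_trans (layer_number_le m0 _ _) _.
- move=> x y xX yX xy; rewrite -enorm_sqr lerXn2r ?nnegrE ?sqrtr_ge0//.
    by rewrite divr_ge0// ltW.
  apply: le_trans ((min_distP n1).2 x y xX yX xy).
  by rewrite -powRN.
- by move=> x /Xball/= x1; rewrite -enorm_sqr expr_le1// sqrtr_ge0.
- rewrite expr_div_n invf_div mulrDl mul1r mulrC lerD2l.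
  by rewrite exprn_ege1.
Unshelve. all: by end_near. Qed.
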